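(* Let $L$ be a bounded chain and $n\geqslant 1$. A function $f\colon L^n\to L$ is horizontally maxitive and satisfies $\mathbf{P_1}$ if and only if there exists a function $g\colon L^n\to L$ satisfying $\mathbf{P_2}$ such that, for every $\mathbf{x}=(x_1,\ldots,x_n)\in L^n$, $$f(\mathbf{x})=\bigvee_{I\subseteq [n]} g\Big(\mathbf{e}_I\wedge\bigwedge_{i\in I}x_i\Big).$$ In this case, we can choose $g=f$ (i.e., $f$ itself satisfies $\mathbf{P_2}$ and the displayed identity holds with $g=f$).
   Context: $L$ is a bounded chain (totally ordered set) with least element $0$, greatest element $1$, and $\wedge=\min$, $\vee=\max$. $[n]=\{1,\ldots,n\}$. $L^n$ carries the componentwise order and operations; for $\mathbf{x}\in L^n$ and $c\in L$, $\mathbf{x}\wedge c=(x_1\wedge c,\ldots,x_n\wedge c)$. $\{0,1\}^n\subseteq L^n$ uses the bounds $0,1$ of $L$. For $I\subseteq[n]$, $\mathbf{e}_I\in\{0,1\}^n$ is the tuple whose $i$th component is $1$ if and only if $i\in I$. The empty meet is $1$. $f\colon L^n\to L$ is horizontally maxitive if $f(\mathbf{x})=f(\mathbf{x}\wedge c)\vee f([\mathbf{x}]_c)$ for all $\mathbf{x}\in L^n$, $c\in L$, where $[\mathbf{x}]_c$ is the $n$-tuple whose $i$th component is $0$ if $x_i\leqslant c$, and $x_i$ otherwise. $\mathbf{P_1}$: $f(\mathbf{e}\wedge c)\leqslant f(\mathbf{e}'\wedge c)$ for all $\mathbf{e},\mathbf{e}'\in\{0,1\}^n$ with $\mathbf{e}\leqslant\mathbf{e}'$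 and all $c\in L$. $\mathbf{P_2}$: $f(\mathbf{e}\wedge c)\leqslant f(\mathbf{e}\wedge c')$ for all $\mathbf{e}\in\{0,1\}^n$ and all $c,c'\in L$ with $c\leqslant c'$. *)

(* Defs.v *)
From mathcomp Require Import all_boot all_order.

Set Implicit Arguments.
Unset Strict Implicit.
Unset Printing Implicit Defensive.

Import Order.TTheory.

Local Open Scope order_scope.

(* L^n is [n.-tupleprod L], whose library order is the componentwise one;
   indices run over 'I_n = {0, ..., n-1} in place of {1, ..., n}.  On a chain
   the lattice operations `&` and `|` are min and max. *)

Section HorizontallyMaxitive.

Context {d : Order.disp_t} {L : tbOrderType d} {n : nat}.

Implicit Types (f g : n.-tupleprod L -> L) (x e : n.-tupleprod L) (c : L).

Definition tmeet x c : n.-tupleprod L := [tuple tnth x i `&` c | i < n].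

Definition ttrunc x c : n.-tupleprod L :=
  [tuple if tnth x i <= c then \bot else tnth x i | i < n].

Definition indic (I : {set 'I_n}) : n.-tupleprod L :=
  [tuple if i \in I then \top else \bot | i < n].

Definition zero_one e : Prop := forall i, tnth e i = \bot \/ tnth e i = \top.

Definition horizontally_maxitive f : Prop :=
  forall x c, f x = f (tmeet x c) `|` f (ttrunc x c).

Definition property_P1 f : Prop :=
  forall e e' c, zero_one e -> zero_one e' -> e <= e' ->
    f (tmeet e c) <= f (tmeet e' c).

Definition property_P2 f : Prop :=
  forall e c c', zero_one e -> c <= c' -> f (tmeet e c) <= f (tmeet e c').

End HorizontallyMaxitive.

(* Main.v *)
Require Import Defs.
From mathcomp Require Import all_boot all_order.

(** If f is horizontally maxitive, cutting x at its least nonzero value c splits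
    f x into f (e_J `&` c), where J is the support of x, and the value of f at a
    tuple with a smaller support; iterating gives "<=" in the identity.  For
    ">=", cutting x at c from above, and then just below c, isolates
    e_J `&` c with J = {i | c <= x_i}, and P1 passes to the subsets I of J.
    Conversely, the right-hand side is monotone in x, and its I-th term is
    bounded by the one at x `&` c or at [x]_c according to whether the meet of
    x over I is below c or not. *)

Import Order.TTheory.

Local Open Scope order_scope.

Section SugenoForm.

Context {d : Order.disp_t} {L : tbOrderType d} {n : nat}.

Implicit Types (f g : n.-tupleprod L -> L) (x y e : n.-tupleprod L) (c : L).
Implicit Types (I J : {set 'I_n}).

Definition join_form g x : L :=
  \join_(I : {set 'I_n}) g (tmeet (indic I) (\meet_(i in I) tnth x i)).

Lemma tnth_tmeet x c i : tnth (tmeet x c) i = tnth x i `&` c.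
Proof. by rewrite tnth_mktuple. Qed.

Lemma tnth_ttrunc x c i :
  tnth (ttrunc x c) i = if tnth x i <= c then \bot else tnth x i.
Proof. by rewrite tnth_mktuple. Qed.

Lemma tnth_tmeet_indic I c i :
  tnth (tmeet (indic I) c) i = if i \in I then c else \bot.
Proof.
by rewrite tnth_tmeet tnth_mktuple; case: ifP; rewrite ?meet1x ?meet0x.
Qed.

Lemma zero_one_indic I : zero_one (indic I : n.-tupleprod L).
Proof. by move=> i; rewrite tnth_mktuple; case: ifP; [right | left]. Qed.

Lemma le_tupleP x y : reflect (forall i, tnth x i <= tnth y i) (x <= y).
Proof. by rewrite leEtprod; apply: forallP. Qed.

Lemma indic_subset I J : I \subset J -> (indic I : n.-tupleprod L) <= indic J.
Proof.
move=> /subsetP sIJ; apply/le_tupleP => i; rewrite !tnth_mktuple.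
by case: ifP => [/sIJ ->|_]; rewrite ?le0x.
Qed.

Lemma tmeet_le x c : tmeet x c <= x.
Proof. by apply/le_tupleP => i; rewrite tnth_tmeet leIl. Qed.

Lemma ttrunc_le x c : ttrunc x c <= x.
Proof. by apply/le_tupleP => i; rewrite tnth_ttrunc; case: ifP; rewrite ?le0x. Qed.

Lemma join_form_ge g x I :
  g (tmeet (indic I) (\meet_(i in I) tnth x i)) <= join_form g x.
Proof. exact: (@joins_sup _ _ _ I). Qed.

Lemma le_meet_tnth x y I :
  x <= y -> \meet_(i in I) tnth x i <= \meet_(i in I) tnth y i.
Proof.
move=> /le_tupleP xy; apply/meetsP => i iI.
exact: le_trans (meets_inf _ iI) (xy i).
Qed.

(** Each meet over [I] grows with [x], and P2 carries this through [g]. This yields P1 and one half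
    of maxitivity for the join form, and lifts the induction bound from a truncated tuple back to
    [x]. *)
Lemma join_form_mono g x y :
  property_P2 g -> x <= y -> join_form g x <= join_form g y.
Proof.
move=> P2 xy; apply/joinsP => I _; apply: le_trans (join_form_ge g y I).
exact/P2/le_meet_tnth/xy/zero_one_indic.
Qed.

Lemma join_form_horizontally_maxitive g :
  property_P2 g -> horizontally_maxitive (join_form g).
Proof.
move=> P2 x c; apply/le_anti/andP; split; last first.
  by rewrite leUx !join_form_mono ?tmeet_le ?ttrunc_le.
apply/joinsP => I _; have P2I := P2 _ _ _ (zero_one_indic I).
have [mc|cm] := leP (\meet_(i in I) tnth x i) c.
  apply: le_trans (leUl _ _); apply: le_trans (join_form_ge g _ I).
  apply: P2I; apply/meetsP => i iI.
  by rewrite tnth_tmeet lexI mc meets_inf.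
apply: le_trans (leUr _ _); apply: le_trans (join_form_ge g _ I).
apply: P2I; apply/meetsP => i iI.
(* Here [c] is strictly below every component indexed by [I], so the truncation leaves these
   components unchanged. *)
have mi : \meet_(j in I) tnth x j <= tnth x i by rewrite meets_inf.
by rewrite tnth_ttrunc (leNgt (tnth x i)) (lt_le_trans cm mi).
Qed.

Lemma join_form_P1 g : property_P2 g -> property_P1 (join_form g).
Proof.
move=> P2 e e' c _ _ /le_tupleP ee'; apply: join_form_mono => //.
by apply/le_tupleP => i; rewrite !tnth_tmeet leI2.
Qed.

Lemma tmeet_tmeet x c c' : c <= c' -> tmeet (tmeet x c') c = tmeet x c.
Proof.
move=> cc'; apply: eq_from_tnth => i.
by rewrite !tnth_tmeet -meetA (meet_r cc').
Qed.

Lemma maxitive_tmeet_le f x c :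
  horizontally_maxitive f -> f (tmeet x c) <= f x.
Proof. by move=> HM; rewrite (HM x c) leUl. Qed.

Lemma maxitive_ttrunc_le f x c :
  horizontally_maxitive f -> f (ttrunc x c) <= f x.
Proof. by move=> HM; rewrite (HM x c) leUr. Qed.

(** For [c <= c'], the tuple at level [c] is the cut at [c] of the tuple at level [c'], and such a
    cut cannot increase [f]. *)
Lemma maxitive_P2 f : horizontally_maxitive f -> property_P2 f.
Proof.
by move=> HM e c c' _ /tmeet_tmeet <-; apply: maxitive_tmeet_le.
Qed.

Lemma maxitive_level_le f x c :
  horizontally_maxitive f ->
  f (tmeet (indic [set i | c <= tnth x i]) c) <= f x.
Proof.
move=> HM; have [->|c0] := eqVneq c \bot.
  rewrite [tmeet _ _](_ : _ = tmeet x \bot) ?maxitive_tmeet_le //.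
  by apply: eq_from_tnth => i; rewrite !tnth_tmeet !meetx0.
(* [b] plays the role of a level just below [c]: no component of [x] lies strictly between them. If
   no component is below [c], then [b] is [\bot], and [b < c] rests on [c0]. *)
pose b := \join_(i | tnth x i < c) tnth x i.
have bc : b < c.
  rewrite /b; elim/big_ind: _ => [|u v uc vc|//]; first by rewrite lt0x.
  by rewrite ltUx uc.
apply: le_trans (maxitive_tmeet_le _ x c HM).
(* Components of [x] that are at least [c] are capped to [c], which exceeds [b] and survives; the
   others are at most [b] and become [\bot]. *)
rewrite [tmeet _ _](_ : _ = ttrunc (tmeet x c) b) ?maxitive_ttrunc_le //.
apply: eq_from_tnth => i.
rewrite tnth_tmeet_indic tnth_ttrunc tnth_tmeet inE.
have [cx|xc] := leP c (tnth x i).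
  by rewrite leNgt bc.
by rewrite /b (joins_sup _ xc).
Qed.

Lemma maxitive_join_form_le f x :
  horizontally_maxitive f -> property_P1 f -> join_form f x <= f x.
Proof.
move=> HM P1; apply/joinsP => I _; set c := \meet_(i in I) _.
apply: le_trans (maxitive_level_le _ x c HM).
apply: P1; [exact: zero_one_indic | exact: zero_one_indic |].
by apply/indic_subset/subsetP => i iI; rewrite inE meets_inf.
Qed.

Lemma maxitive_le_join_form f x :
  horizontally_maxitive f -> f x <= join_form f x.
Proof.
move=> HM; pose supp y := [set i | tnth y i != \bot].
have [m] := ubnP #|supp x|; elim: m x => // m IHm x /ltnSE-le_m.
have [s0|[i0 i0s]] := set_0Vmem (supp x).
  (* With empty support [x] is the zero tuple, which is the argument of the term indexed by the
     empty set. *)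
  rewrite [f x](_ : _ = f (tmeet (indic set0) (\meet_(i in set0) tnth x i))).
    exact: join_form_ge.
  congr f; apply: eq_from_tnth => i; rewrite tnth_tmeet_indic in_set0.
  have: i \notin supp x by rewrite s0 inE.
  by rewrite inE negbK => /eqP.
have [i is_ xi_min] := arg_minP (fun i => tnth x i) i0s.
(* Written as a meet, the least nonzero value is exactly the level in the term of index [supp x]. *)
pose c := \meet_(j in supp x) tnth x j.
have ci : c = tnth x i.
  apply/le_anti/andP; split; first by rewrite /c meets_inf.
  by apply/meetsP => j js; apply: xi_min.
rewrite (HM x c) leUx; apply/andP; split.
  rewrite [tmeet _ _](_ : _ = tmeet (indic (supp x)) c) ?join_form_ge //.
  apply: eq_from_tnth => j; rewrite tnth_tmeet_indic tnth_tmeet.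
  case: ifP => [js|]; first by apply/meet_r; rewrite /c meets_inf.
  by rewrite inE => /negbFE/eqP->; rewrite meet0x.
apply: le_trans (join_form_mono f _ _ (maxitive_P2 _ HM) (ttrunc_le x c)).
(* The support shrinks strictly: the index [i], where the minimum [c] is attained, is truncated to
   [\bot]. *)
apply: IHm; apply: leq_trans le_m; apply/proper_card/properP; split.
  apply/subsetP => j; rewrite !inE tnth_ttrunc; case: ifP => // _.
  by rewrite eqxx.
by exists i => //; rewrite inE tnth_ttrunc ci lexx eqxx.
Qed.

Lemma maxitive_eq_join_form f :
  horizontally_maxitive f -> property_P1 f -> f =1 join_form f.
Proof.
move=> HM P1 x; apply/le_anti.
by rewrite maxitive_le_join_form ?maxitive_join_form_le.
Qed.

End SugenoForm.

Theorem theorem3 (d : Order.disp_t) (L : tbOrderType d) (n : nat)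
    (hn : (1 <= n)%N) (f : n.-tupleprod L -> L) :
  ((horizontally_maxitive f /\ property_P1 f) <->
   (exists g : n.-tupleprod L -> L,
      property_P2 g /\
      forall x : n.-tupleprod L,
        f x = \join_(I : {set 'I_n})
                g (tmeet (indic I) (\meet_(i in I) tnth x i)))) /\
  (horizontally_maxitive f /\ property_P1 f ->
   property_P2 f /\
   forall x : n.-tupleprod L,
     f x = \join_(I : {set 'I_n})
             f (tmeet (indic I) (\meet_(i in I) tnth x i))).
Proof.
(* The forward direction is proved with [f] itself as [g], which serves both the equivalence and the
   final claim. *)
have chooses_f : horizontally_maxitive f /\ property_P1 f ->
    property_P2 f /\ f =1 join_form f.
  move=> [HM P1]; split; first exact: maxitive_P2.
  exact: maxitive_eq_join_form.
split=> //; split=> [/chooses_f|[g [P2 fE]]]; first by exists f.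
have {}fE : f =1 join_form g := fE.
split=> [x c | e e' c e01 e'01 ee']; rewrite !fE.
  exact: join_form_horizontally_maxitive.
exact: join_form_P1.
Qed.
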